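(* Let $a<b$ be real numbers, let $n\ge 1$, let $f\in C^{n-1}([a,b])$ and assume that $f^{(n)}(x)$ exists at each point $x\in(a,b)$. Let $\mathcal S=\{s_1,\dots,s_n\}$ be a collection of segments contained in $[a,b]$ such that $|s_i\cap s_j|=0$ whenever $i\ne j$. If $p_{n-1}\in\mathbb P_{n-1}$ is the unique polynomial satisfying $$\frac{1}{|s_i|}\int_{s_i} f(x)\,\mathrm dx=\frac{1}{|s_i|}\int_{s_i}p_{n-1}(x)\,\mathrm dx,\qquad i=1,\dots,n,$$ then there exist points $\xi_1,\dots,\xi_n\in[a,b]$ such that for every $x\in[a,b]$ there exists $\bar\xi\in[a,b]$ (a point at which $f^{(n)}$ exists) with $$f(x)-p_{n-1}(x)=\frac{\prod_{i=1}^n(x-\xi_i)}{n!}\,f^{(n)}(\bar\xi).$$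
   Context: $\mathbb P_{n-1}$ is the space of real univariate polynomials of degree at most $n-1$. A segment is a compact interval $s=[\alpha,\beta]$ with $\alpha<\beta$, and $|\cdot|$ denotes length (Lebesgue measure), so $|s_i\cap s_j|=0$ means that $s_i$ and $s_j$ intersect at most in an endpoint. $C^{n-1}([a,b])$ is the space of functions with continuous derivatives up to order $n-1$ on $[a,b]$. *)

(* Defs.v *)
(* MathComp-Analysis, over an arbitrary R : realType. *)
From HB Require Import structures.
From mathcomp Require Export all_boot all_order all_algebra.
From mathcomp Require Export all_classical all_reals all_analysis.
Export Order.TTheory GRing.Theory Num.Theory.
Export numFieldNormedType.Exports.

Set Implicit Arguments.
Unset Strict Implicit.
Unset Printing Implicit Defensive.

Local Open Scope classical_set_scope.
Local Open Scope ring_scope.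

Section DerivativesOnASet.
Context {R : realType}.
Implicit Types (A : set R) (f : R -> R) (x : R).

(* A function on A = [a, b] is encoded as a total function R -> R whose values
   outside A are never used.  The derivative is therefore taken relative to A
   (y tends to x with y in A and y != x): it is the ordinary two-sided
   derivative at interior points and the one-sided one at a and b. *)
Definition difference_quotient f x : R -> R := fun y => (f y - f x) / (y - x).

Definition derivable_on A f x : Prop :=
  cvg (difference_quotient f x @ within A x^').

(* Meaningful at x only under derivable_on A f x. *)
Definition derive_on A f : R -> R :=
  fun x => lim (difference_quotient f x @ within A x^').

Definition derive_onn A k f : R -> R := iter k (derive_on A) f.

Definition C_on A m f : Prop :=
  (forall k, (k < m)%N ->
     forall x, A x -> derivable_on A (derive_onn A k f) x) /\
  (forall k, (k <= m)%N -> {within A, continuous (derive_onn A k f)}).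

(* For k > 0 only: existence at x of the last of the k derivatives; that of the
   lower ones near x has to be known separately (here, from C_on A k.-1 f). *)
Definition nderivable_on A k f x : Prop :=
  derivable_on A (derive_onn A k.-1 f) x.

End DerivativesOnASet.

Definition is_segment {R : realType} (s : set R) : Prop :=
  exists alpha beta : R, alpha < beta /\ s = `[alpha, beta]%classic.

Definition seg_length {R : realType} (s : set R) : R :=
  fine (lebesgue_measure s).

Definition seg_average {R : realType} (s : set R) (f : R -> R) : R :=
  (seg_length s)^-1 * \int[lebesgue_measure]_(x in s) f x.

(* Main.v *)
Require Import Defs.
From mathcomp Require Import ring.

(** The averages of [f] and [p] over a segment agree, so the primitive of
    [f - p] takes the same value at both endpoints and Rolle's theorem makes
    [f - p] vanish at an interior point of the segment
    ([seg_average_eq_crossing]).  Two of the segments meet in a null set, hence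
    their interiors are disjoint ([itvcc_setI_measure_neq0]) and the [n] zeros
    found this way are distinct: [p] is the Lagrange interpolant of [f] at
    nodes [xi_1, ..., xi_n] in [[a, b]].

    What remains is Cauchy's remainder formula for Lagrange interpolation
    ([interpolation_remainder]).  Put [w = \prod_i ('X - xi_i)].  At a point
    [x] other than the nodes, choose the constant [K] for which
    [f - p - K w] vanishes at [x] as well; this function has [n + 1]
    distinct zeros, so by iterating Rolle's theorem ([rolle_iter]) its [n]-th
    derivative vanishes somewhere.  As [p^(n) = 0] and [w^(n) = n!], this
    reads [f^(n)(c) = n! K], which is the formula.  At a node both sides are
    [0], whatever the point at which [f^(n)] is taken.

    The derivatives of [f] are relative to [[a, b]]; Rolle's theorem only looks
    at interior points, where they are ordinary derivatives
    ([is_derive_derive_on]). *)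

Set Implicit Arguments.
Unset Strict Implicit.
Unset Printing Implicit Defensive.
Local Open Scope classical_set_scope.
Local Open Scope ring_scope.

Lemma within_dnbhs_itvcc (R : realType) (a b x : R) :
  x \in `]a, b[ -> within `[a, b]%classic x^' = x^'.
Proof.
move=> xab; apply/seteqP; split => P /=; rewrite /within /dnbhs /within /= => xP.
  have nab : \forall y \near x, y \in `]a, b[ by exact: near_in_itvoo.
  apply: filterS2 nab xP => y yab yP yx; apply: yP => //.
  exact: subset_itv_oo_cc yab.
by apply: filterS xP => y yP yx _; exact: yP.
Qed.

(** Near an interior point, approaching within [[a, b]] is no constraint, so the
    two difference quotients differ only by the substitution [y = h + x].  This
    is what makes Rolle's theorem apply to relative derivatives. *)
Lemma is_derive_derive_on (R : realType) (a b x : R) (f : R -> R) :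
  x \in `]a, b[ -> derivable_on `[a, b]%classic f x ->
  is_derive x 1 f (derive_on `[a, b]%classic f x).
Proof.
rewrite /derivable_on /derive_on => xab; rewrite within_dnbhs_itvcc// => df.
have shiftx : h + x @[h --> 0^'] --> x^'.
  move=> P xP; have {}xP : \forall y \near x, y != x -> P y by [].
  rewrite (near_shift 0 x) subr0 in xP.
  suff : \forall h \near (0 : R), h != 0 -> P (h + x) by [].
  apply: filterS xP => h /= hP h0; apply: hP.
  by rewrite -subr_eq0 /shift /= addrK.
have df0 := cvg_comp _ _ shiftx df.
have E : difference_quotient f x \o (fun h => h + x) =
         (fun h => h^-1 *: ((f \o shift x) (h *: 1) - f x)).
  apply/funext => h; rewrite /difference_quotient /= /shift /= addrK.
  by rewrite [h *: 1]mulr1 mulrC.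
rewrite /= E in df0.
split; first by apply/cvg_ex; eexists; exact: df0.
by apply/cvg_lim.
Qed.

(** Rolle's theorem between consecutive zeros of [F 0] yields one zero of [F 1]
    in each gap, still in increasing order, and one fewer; induction on [n]
    does the rest.  The sequence [F] stands for the successive derivatives of
    [F 0], so that derivatives of any kind can be plugged in. *)
Lemma rolle_iter (R : realType) (a b : R) (n : nat) (F : nat -> R -> R)
    (z : nat -> R) :
  (0 < n)%N ->
  (forall k, (k < n)%N -> {within `[a, b], continuous (F k)}) ->
  (forall k, (k < n)%N -> forall x, x \in `]a, b[ ->
     is_derive x 1 (F k) (F k.+1 x)) ->
  (forall i, (i <= n)%N -> z i \in `[a, b] /\ F 0%N (z i) = 0) ->
  (forall i, (i < n)%N -> z i < z i.+1) ->
  exists2 c, c \in `]a, b[ & F n c = 0.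
Proof.
elim: n F z => // n IH F z _ cF dF z0 zS.
(* A choice function needs a value at every index: 0 is the default past the
   last gap. *)
have step i : exists c : R, (i <= n)%N -> z i < c < z i.+1 /\ F 1%N c = 0.
  case: (leqP i n) => [lein|]; last by exists 0.
  have [/itvP ziab Fi] := z0 i (leqW lein).
  have [/itvP ziSab FiS] := z0 i.+1 lein.
  have oo : `]z i, z i.+1[ `<=` `]a, b[.
    by apply: subset_itv; rewrite bnd_simp ?ziab ?ziSab.
  have [|||c cab dc] := @Rolle R (F 0%N) (z i) (z i.+1) (zS i lein).
  - by move=> x /oo xab; have [] := dF 0%N isT x xab.
  - apply: continuous_subspaceW (cF 0%N isT).
    by apply: subset_itv; rewrite bnd_simp ?ziab ?ziSab.
  - by rewrite Fi FiS.
  exists c => _; split; first by move: cab; rewrite in_itv.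
  have dc' := dF 0%N isT c (oo _ cab).
  by rewrite -(@derive_val _ _ _ _ _ _ _ dc') (@derive_val _ _ _ _ _ _ _ dc).
have [w wP] := choice step.
have wab i : (i <= n)%N -> w i \in `]a, b[.
  move=> lein; have [/andP[zw wz] _] := wP i lein.
  have [/itvP ziab _] := z0 i (leqW lein).
  have [/itvP ziSab _] := z0 i.+1 lein.
  rewrite in_itv/= (le_lt_trans _ zw) ?ziab//=.
  by rewrite (lt_le_trans wz) ?ziSab.
(* For a single gap the zero just found is the answer. *)
case: n IH cF dF zS wP wab {z0 step} => [|n] IH cF dF zS wP wab.
  by exists (w 0%N); [exact: wab|case: (wP 0%N isT)].
apply: (IH (fun k => F k.+1) w isT).
- by move=> k kn; exact: cF.
- by move=> k kn x; exact: dF.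
- by move=> i lein; split; [exact/subset_itv_oo_cc/wab|case: (wP i lein)].
- move=> i ltin; have [/andP[_ wz] _] := wP i (ltnW ltin).
  by have [/andP[zw _] _] := wP i.+1 ltin; exact: lt_trans zw.
Qed.

Lemma rolle_iter_seq (R : realType) (a b : R) (n : nat) (F : nat -> R -> R)
    (zs : seq R) :
  (0 < n)%N ->
  (forall k, (k < n)%N -> {within `[a, b], continuous (F k)}) ->
  (forall k, (k < n)%N -> forall x, x \in `]a, b[ ->
     is_derive x 1 (F k) (F k.+1 x)) ->
  uniq zs -> size zs = n.+1 ->
  (forall z, z \in zs -> z \in `[a, b] /\ F 0%N z = 0) ->
  exists2 c, c \in `]a, b[ & F n c = 0.
Proof.
move=> n0 cF dF zsU zsn zsP.
pose t := sort <=%R zs.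
have tn : size t = n.+1 by rewrite size_sort.
have tlt : sorted <%R t by rewrite sort_lt_sorted.
apply: (@rolle_iter R a b n F (nth 0 t)) => // i lein.
- by apply: zsP; rewrite -(mem_sort <=%R) mem_nth// tn.
- by apply: (sorted_ltn_nth lt_trans) => //; rewrite inE tn ltnS// ltnW.
Qed.

(** The primitive [G] of [g] vanishes at both [a] and [b], so Rolle's
    theorem applies to [G]; it puts the zero of [g = G'] in the open interval,
    away from the endpoints that two segments may share. *)
Lemma Rintegral0_zero (R : realType) (a b : R) (g : R -> R) :
  a < b -> {within `[a, b], continuous g} ->
  \int[lebesgue_measure]_(x in `[a, b]) g x = 0 ->
  exists2 c, c \in `]a, b[ & g c = 0.
Proof.
move=> ab cg g0.
have ig : lebesgue_measure.-integrable `[a, b] (EFin \o g).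
  by apply: continuous_compact_integrable => //; exact: segment_compact.
pose G x := \int[lebesgue_measure]_(t in `[a, x]) g t.
have dG x : x \in `]a, b[ -> is_derive x 1 G (g x).
  move=> xab; have /andP[ax xb] : a < x < b by move: xab; rewrite in_itv.
  have [cgo _ _] := (continuous_within_itvP g ab).1 cg.
  have [dG G'] := continuous_FTC1_closed xb ig ax (cgo x xab).
  by apply: DeriveDef; [exact: dG|rewrite -derive1E G'].
have [|||c cab dc] := @Rolle R G a b ab.
- by move=> x /dG[].
- exact: parameterized_integral_continuous (ltW ab) ig.
- by rewrite {2}/G g0 /G set_itv1 Rintegral_set1.
exists c => //.
have dc' := dG c cab.
by rewrite -(@derive_val _ _ _ _ _ _ _ dc') (@derive_val _ _ _ _ _ _ _ dc).
Qed.

Lemma derivn_monic (R : comNzRingType) (n : nat) (q : {poly R}) :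
  q \is monic -> size q = n.+1 -> q^`(n) = n`!%:R%:P.
Proof.
move=> qm qn; apply/polyP => i; rewrite coef_derivn coefC.
case: i => [|i] /=.
  by move/monicP: qm; rewrite lead_coefE qn addn0 /= ffactnn => ->.
by rewrite nth_default ?mul0rn// qn addnS ltnS leq_addr.
Qed.

(** Both hypotheses serve: the first for the derivatives of order below [n - 1],
    the second for the one of order [n - 1]. *)
Lemma is_derive_derive_onn (R : realType) (a b : R) (n : nat) (f : R -> R) :
  C_on `[a, b]%classic n.-1 f ->
  (forall x : R, x \in `]a, b[ -> nderivable_on `[a, b]%classic n f x) ->
  forall k, (k < n)%N -> forall x, x \in `]a, b[ ->
  is_derive x 1 (derive_onn `[a, b]%classic k f)
    (derive_onn `[a, b]%classic k.+1 f x).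
Proof.
move=> [df _] dnf k kn x xab; apply: is_derive_derive_on => //.
have [kn1|] := ltnP k n.-1.
  by apply: df => //; exact: subset_itv_oo_cc xab.
case: n dnf kn {df} => // n dnf; rewrite ltnS => kn nk.
by have -> : k = n; [apply/eqP; rewrite eqn_leq kn nk|exact: dnf].
Qed.

(** Cauchy's remainder formula for Lagrange interpolation.  The constant [K]
    below adds [x] to the zeros of [f - p - K w], where [w] is the nodal
    polynomial. *)
Lemma interpolation_remainder (R : realType) (a b : R) (n : nat) (f : R -> R)
    (p : {poly R}) (xi : 'I_n -> R) (x : R) :
  (0 < n)%N ->
  C_on `[a, b]%classic n.-1 f ->
  (forall x : R, x \in `]a, b[ -> nderivable_on `[a, b]%classic n f x) ->
  (size p <= n)%N ->
  injective xi ->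
  (forall i, xi i \in `[a, b] /\ f (xi i) = p.[xi i]) ->
  x \in `[a, b] -> (forall i, x != xi i) ->
  exists2 c, c \in `]a, b[ &
    f x - p.[x] =
      (\prod_(i < n) (x - xi i)) / n`!%:R * derive_onn `[a, b]%classic n f c.
Proof.
move=> n0 Cf dnf pn xi_inj xiP xab xxi.
pose w : {poly R} := \prod_(i < n) ('X - (xi i)%:P).
have wE y : w.[y] = \prod_(i < n) (y - xi i).
  by rewrite horner_prod; apply: eq_bigr => i _; rewrite !hornerE.
have wx0 : w.[x] != 0.
  by rewrite wE; apply/prodf_neq0 => i _; rewrite subr_eq0.
pose K := (f x - p.[x]) / w.[x].
pose q := p + K *: w.
pose F k := derive_onn `[a, b]%classic k f \- horner q^`(k).
have [|||||c cab Fc] := @rolle_iter_seq R a b n F (x :: codom xi) n0.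
- move=> k kn.
  have cf : {within `[a, b], continuous (derive_onn `[a, b]%classic k f)}.
    by apply: Cf.2; rewrite -ltnS prednK.
  have cq : {within `[a, b], continuous (horner q^`(k))}.
    by apply: continuous_subspaceT; exact: continuous_horner.
  by move=> y; apply: cvgB; [exact: cf|exact: cq].
- move=> k kn y yab; rewrite /F/=.
  have df := is_derive_derive_onn Cf dnf kn yab.
  have dq := is_derive_poly q^`(k) y.
  exact: is_deriveB df dq.
- rewrite cons_uniq; apply/andP; split; last exact/injectiveP.
  by apply/codomP => -[i] /eqP; rewrite (negPf (xxi i)).
- by rewrite /= size_codom card_ord.
- move=> z; rewrite inE => /predU1P[->|/codomP[i ->]].
    by split=> //; rewrite /F/= /q !hornerE divfK// subrKC subrr.
  have [xiab fxi] := xiP i; split=> //.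
  rewrite /F/= /q !hornerE fxi.
  suff -> : w.[xi i] = 0 by rewrite mulr0 addr0 subrr.
  by rewrite wE (bigD1 i)//= subrr mul0r.
exists c => //; rewrite -wE.
have wm : w \is monic by exact: monic_prod_XsubC.
have wn : size w = n.+1 by rewrite size_prod_XsubC /index_enum -enumT size_enum_ord.
have nf0 : n`!%:R != 0 :> R by rewrite pnatr_eq0 -lt0n fact_gt0.
move: Fc; rewrite /F/= derivnD derivnZ (derivn_monic wm wn) derivn_poly0//.
rewrite add0r hornerZ hornerC => /eqP; rewrite subr_eq0 => /eqP ->.
by rewrite /K; field; rewrite wx0 nf0.
Qed.

(** If [c] is interior to both segments, their intersection contains the
    nondegenerate interval from the larger left endpoint to [c]. *)
Lemma itvcc_setI_measure_neq0 (R : realType) (a1 b1 a2 b2 c : R) :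
  c \in `]a1, b1[ -> c \in `]a2, b2[ ->
  lebesgue_measure (`[a1, b1]%classic `&` `[a2, b2]%classic) != 0%E.
Proof.
rewrite !in_itv/= => /andP[a1c cb1] /andP[a2c cb2].
pose m := Num.max a1 a2.
have mc : m < c by rewrite gt_max a1c.
rewrite gt_eqF//; apply: (@lt_le_trans _ _ (lebesgue_measure `[m, c]%classic)).
  by rewrite lebesgue_measure_itv/= lte_fin mc -EFinD lte_fin subr_gt0.
apply: le_measure; rewrite ?inE//=; first exact: measurableI.
by rewrite subsetI; split; apply: subset_itv;
  rewrite bnd_simp /m ?le_max ?lexx ?orbT// ltW.
Qed.

(** That the crossing point is interior is what makes the nodes of different
    segments distinct. *)
Lemma seg_average_eq_crossing (R : realType) (a b : R) (f g : R -> R) :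
  a < b -> {within `[a, b], continuous f} -> {within `[a, b], continuous g} ->
  seg_average `[a, b]%classic f = seg_average `[a, b]%classic g ->
  exists2 c, c \in `]a, b[ & f c = g c.
Proof.
move=> ab cf cg; rewrite /seg_average => /mulfI.
have -> : (seg_length `[a, b]%classic)^-1 != 0.
  rewrite invr_eq0 /seg_length lebesgue_measure_itv/= lte_fin ab -EFinD/=.
  by rewrite subr_eq0 gt_eqF.
move=> /(_ isT) fg.
have [||c cab /eqP fgc] := @Rintegral0_zero R a b (f \- g) ab.
- by move=> y; apply: cvgB; [exact: cf|exact: cg].
- by rewrite RintegralB//= ?fg ?subrr//; apply: continuous_compact_integrable => //;
    exact: segment_compact.
- by exists c => //; apply/eqP; rewrite -subr_eq0.
Qed.

Theorem proposition1 (R : realType) (a b : R) (n : nat) (f : R -> R)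
    (s : 'I_n -> set R) (p : {poly R}) :
  a < b ->
  (1 <= n)%N ->
  C_on `[a, b]%classic n.-1 f ->
  (forall x : R, x \in `]a, b[ -> nderivable_on `[a, b]%classic n f x) ->
  (forall i : 'I_n, is_segment (s i)) ->
  (forall i : 'I_n, s i `<=` `[a, b]%classic) ->
  (forall i j : 'I_n, i != j -> lebesgue_measure (s i `&` s j) = 0%E) ->
  (size p <= n)%N ->
  (forall i : 'I_n,
     seg_average (s i) f = seg_average (s i) (fun x => p.[x])) ->
  exists xi : 'I_n -> R,
    (forall i : 'I_n, xi i \in `[a, b]) /\
    forall x : R, x \in `[a, b] ->
      exists xibar : R,
        xibar \in `[a, b] /\
        nderivable_on `[a, b]%classic n f xibar /\
        f x - p.[x] =
          (\prod_(i < n) (x - xi i)) / n`!%:R * derive_onn `[a, b]%classic n f xibar.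
Proof.
move=> ab n0 Cf dnf seg sab disj pn avg.
have crossing i : exists c : R, exists e : R * R,
    [/\ s i = `[e.1, e.2]%classic, c \in `]e.1, e.2[ & f c = p.[c]].
  have [al [be [albe sE]]] := seg i.
  have cf : {within `[al, be], continuous f}.
    by apply: continuous_subspaceW (Cf.2 0%N (leq0n _)); rewrite -sE; exact: sab.
  have cp : {within `[al, be], continuous (horner p)}.
    by apply: continuous_subspaceT; exact: continuous_horner.
  have := avg i; rewrite sE => /(seg_average_eq_crossing albe cf cp)[c cab fc].
  by exists c, (al, be).
have [xi xiP] := choice crossing.
have xiab i : xi i \in `[a, b].
  have [e [sE ce _]] := xiP i.
  by apply: (sab i); rewrite sE; exact: subset_itv_oo_cc ce.
have xi_inj : injective xi.
  move=> i j ij; apply/eqP/negP => /negP /disj/eqP; apply/negP.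
  have [e1 [-> ce1 _]] := xiP i; have [e2 [-> ce2 _]] := xiP j.
  by apply: itvcc_setI_measure_neq0 ce1 _; rewrite ij.
exists xi; split=> // x xab.
have [[i xi_x]|nonode] := pselect (exists i, x = xi i).
  have mab : (a + b) / 2 \in `]a, b[ by rewrite in_itv/= midf_lt// midf_lt.
  exists ((a + b) / 2); split; first exact: subset_itv_oo_cc.
  split; first exact: dnf.
  have [e [_ _ fxi]] := xiP i.
  by rewrite (bigD1 i)//= xi_x subrr !mul0r fxi subrr.
have [|||c cab fx] := @interpolation_remainder R a b n f p xi x n0 Cf dnf pn xi_inj.
- by move=> i; split=> //; case: (xiP i) => e [].
- by [].
- by move=> i; apply/eqP => xxi; apply: nonode; exists i.
exists c; split; first exact: subset_itv_oo_cc.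
by split; first exact: dnf.
Qed.
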